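(* Let $q$ be a prime power and $n$ a positive integer. Except in the case $q = 2$ and $n = 1$, $$\prod_{\substack{p \in \mathcal{I}_q \\ \deg p \le n}} \left(1 - \frac{1}{\|p\|}\right) > \frac{1}{e^{\gamma}(n+1)}.$$
   Context: $\mathcal{I}_q$ is the set of monic irreducible polynomials in $\mathbb{F}_q[x]$, $\|p\| = q^{\deg p}$, and $\gamma$ is the Euler–Mascheroni constant. *)

(* Defs.v *)
From mathcomp Require Import all_boot all_order all_algebra.
From mathcomp Require Import all_classical all_reals all_analysis.
From mathcomp Require Import lra.

Set Implicit Arguments.
Unset Strict Implicit.
Unset Printing Implicit Defensive.

Import Order.TTheory GRing.Theory Num.Theory.
Import numFieldNormedType.Exports.

Local Open Scope ring_scope.
Local Open Scope classical_set_scope.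

Definition euler_seq (R : realType) (m : nat) : R :=
  \sum_(1 <= k < m.+1) k%:R^-1 - ln m%:R.

Definition euler_gamma (R : realType) : R := limn (@euler_seq R).

(* [limn] is only meaningful for a convergent sequence. *)
Lemma is_cvg_euler_seq (R : realType) : cvgn (@euler_seq R).
Proof.
suff: cvgn [sequence euler_seq R m.+1]_m by rewrite /= cvg_shiftS => /cvgP.
apply: nonincreasing_is_cvgn.
- apply/nonincreasing_seqP => m; rewrite /euler_seq/=.
  rewrite [in leLHS]big_nat_recr//=.
  have m2 : m.+2%:R != 0 :> R by rewrite pnatr_eq0.
  have E : m.+1%:R / m.+2%:R = 1 + (- m.+2%:R^-1) :> R.
    by rewrite -[in LHS](addrK 1 m.+1%:R) natr1 mulrBl divff// mul1r.
  have := @le_ln1Dx R (- m.+2%:R^-1).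
  rewrite -E ln_div ?posrE ?ltr0n// ltrN2 invf_lt1 ?ltr0n// ltr1n => /(_ isT).
  move: (ln _) (ln _) (_^-1) (\sum_(1 <= _ < _) _) => a b c d; lra.
- exists 0 => _ [m _ <-]; rewrite /euler_seq subr_ge0.
  case: m => [|m]; first by rewrite big_nat1 ln1 invr1 ler01.
  suff: ln (m.+2%:R : R) <= \sum_(1 <= k < m.+2) k%:R^-1.
    by move=> h; rewrite big_nat_recr//= (le_trans h)// lerDl invr_ge0.
  elim: m => [|m IHm].
    by rewrite big_nat1 invr1; have := @le_ln1Dx R 1; rewrite -natr1; apply; lra.
  rewrite big_nat_recr//=.
  have m2 : m.+2%:R != 0 :> R by rewrite pnatr_eq0.
  have E : m.+3%:R / m.+2%:R = 1 + m.+2%:R^-1 :> R.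
    by rewrite -natr1 mulrDl divff// mul1r.
  have := @le_ln1Dx R (m.+2%:R^-1).
  have h : -1 < m.+2%:R^-1 :> R by rewrite (@lt_trans _ _ 0) ?invr_gt0 ?ltrN10.
  rewrite -E ln_div ?posrE ?ltr0n// => /(_ h).
  move: IHm; move: (ln _) (ln _) (_^-1) (\sum_(1 <= _ < _) _) => a b c d; lra.
Qed.

Definition monic_irreducible (F : finFieldType) : pred {poly F} :=
  [pred p | (p \is monic) && irreducibleb p].

Definition poly_norm (F : finFieldType) (p : {poly F}) : nat :=
  (#|F| ^ (size p).-1)%N.

(* Main.v *)
(* With c_d the number of monic irreducible polynomials of degree d, the
   polynomial 'X^(q^m) - 'X is divisible by every monic irreducible whose degree
   divides m, so \sum_(d | m) d c_d <= q^m. Expanding -ln (1 - q^-d) up to the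
   order n / d, the main terms of -ln (\prod_(d <= n) (1 - q^-d)^(c_d)) regroup
   by m = d j into at most H_n = 1 + ... + 1/n, and the Taylor remainders add up
   to at most 1 / (2 (n + 1)) when q > 2 or n > 3. Since the sequence
   H_N - ln N - 1 / (2 N) increases strictly to gamma, taking N = n + 1 yields
   -ln (\prod ...) < gamma + ln (n + 1). For q = 2 and n = 2, 3 the product is
   bounded below directly and compared with e^gamma > 16/9. *)
Require Import Defs.
From mathcomp Require Import all_boot all_order all_algebra.
From mathcomp Require Import all_classical all_reals all_analysis.
From mathcomp Require Import qfpoly finfield.
From mathcomp Require Import ring lra zify.

Set Implicit Arguments.
Unset Strict Implicit.
Unset Printing Implicit Defensive.

Import Order.TTheory GRing.Theory Num.Theory.
Import numFieldNormedType.Exports.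

Local Open Scope ring_scope.

(** * Counting monic irreducibles over a finite field *)

Lemma iter_expr_fixed (A : pzSemiRingType) (x : A) (N k : nat) :
  x ^+ N = x -> x ^+ (N ^ k) = x.
Proof. by move=> xN; elim: k => // k IHk; rewrite expnS exprM xN. Qed.

(** The quotient by [p] is a field with q^(deg p) elements, so the class of ['X] is fixed by the
    power q^(deg p), hence by its iterate q^m. *)
Lemma monic_irreducible_dvdp (F : finFieldType) (p : {poly F}) (m : nat) :
  monic_irreducible p -> ((size p).-1 %| m)%N ->
  p %| 'X^(#|F| ^ m) - 'X.
Proof.
move=> /andP[p_monic /irreducibleP p_irr] /dvdnP[k ->].
pose hI : monic_irreducible_poly p := (p_irr, p_monic).
have xq : (in_qpoly p 'X : {poly %/ p with hI}) ^+ (#|F| ^ (size p).-1) = in_qpoly p 'X.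
  by rewrite -(card_qfpoly hI) finfield.expf_card.
have := iter_expr_fixed k xq.
rewrite -expnM mulnC => xqk.
have : in_qpoly p ('X^(#|F| ^ (k * (size p).-1)) - 'X) = 0 :> {poly %/ p with hI}.
  by rewrite linearB /= rmorphXn /= xqk subrr.
move=> /(congr1 val) /=.
rewrite (mk_monicE hI) => h.
by rewrite /dvdp; move/eqP: h; rewrite Pdiv.IdomainMonic.modpE.
Qed.

Lemma coprimep_monic_irreducible (F : finFieldType) (p r : {poly F}) :
  monic_irreducible p -> monic_irreducible r -> p != r -> coprimep p r.
Proof.
move=> /andP[p_monic /irreducibleP p_irr] /andP[r_monic /irreducibleP r_irr] pr.
rewrite irreducible_poly_coprime//; apply: contra pr => prd.
rewrite -eqp_monic//.
by case: r_irr => _ /(_ p) ->//; case: p_irr => p1 _; rewrite neq_ltn p1 orbT.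
Qed.

Lemma prod_coprimep_dvdp (F : fieldType) (I : eqType) (s : seq I)
    (f : I -> {poly F}) (g : {poly F}) : uniq s ->
  {in s &, forall i j, i != j -> coprimep (f i) (f j)} ->
  {in s, forall i, f i %| g} -> \prod_(i <- s) f i %| g.
Proof.
elim: s => [|i s IHs]; first by rewrite big_nil dvd1p.
move=> /= /andP[i_s s_uniq] cop dv; rewrite big_cons Gauss_dvdp.
  rewrite dv ?mem_head// IHs// => [j k js ks|j js].
    by apply: cop; rewrite inE (js, ks) orbT.
  by rewrite dv// inE js orbT.
rewrite big_seq; elim/big_ind: _ => [|p r|j js]; first exact: coprimep1.
  by rewrite coprimepMr => -> ->.
by rewrite cop ?mem_head ?inE ?js ?orbT//; apply: contraNneq i_s => ->.
Qed.

(** The [p] counted are pairwise coprime divisors of ['X^(#|F| ^ m) - 'X], so their product divides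
    it, and degrees are compared; [0 < m] gives that polynomial degree [#|F| ^ m]. *)
Lemma sum_deg_monic_irreducible_le (F : finFieldType) (n m : nat)
    (P : pred {poly_n F}) : (0 < m)%N ->
  (forall p, P p -> monic_irreducible p /\ ((size p).-1 %| m)%N) ->
  (\sum_(p : {poly_n F} | P p) (size p).-1 <= #|F| ^ m)%N.
Proof.
move=> m_gt0 hP.
have q_gt1 : (1 < #|F|)%N := card_finNzRing_gt1 F.
have qm_gt1 : (1 < #|F| ^ m)%N by rewrite -(exp1n m) ltn_exp2r.
have P0 (p : {poly_n F}) : P p -> (p : {poly F}) != 0.
  by move=> /hP[/andP[/monic_neq0]].
have sX : size ('X^(#|F| ^ m) - 'X : {poly F}) = (#|F| ^ m).+1.
  by rewrite size_polyDl ?size_polyXn// size_polyN size_polyX.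
have dv : \prod_(p : {poly_n F} | P p) (p : {poly F}) %| 'X^(#|F| ^ m) - 'X.
  rewrite -big_filter; apply: prod_coprimep_dvdp.
  - by rewrite filter_uniq// index_enum_uniq.
  - move=> p r; rewrite !mem_filter => /andP[/hP[p_irr _] _] /andP[/hP[r_irr _] _] pr.
    exact: coprimep_monic_irreducible.
  - by move=> p; rewrite mem_filter => /andP[/hP[p_irr pm] _]; exact: monic_irreducible_dvdp.
have := dvdp_leq _ dv; rewrite -size_poly_eq0 sX => /(_ isT).
rewrite size_prod// (eq_bigr (fun p : {poly_n F} => (size p).-1 + 1)%N).
  by rewrite big_split/= sum1_card -addSn addnK ltnS.
by move=> p /P0; rewrite -size_poly_gt0 addn1 => /prednK.
Qed.

(** The ambient [{poly_n.+1 F}] makes the set finite; for [d <= n] it holds every polynomial of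
    degree [d]. *)
Definition nb_monic_irreducible (F : finFieldType) (n d : nat) : nat :=
  #|[pred p : {poly_n.+1 F} | monic_irreducible p && (size p == d.+1)]|.

Lemma deg_monic_irreducible (F : finFieldType) (n : nat) (p : {poly_n.+1 F}) :
  monic_irreducible p -> (0 < (size p).-1 < n.+1)%N.
Proof.
move=> /andP[_ /irreducibleP[p1 _]].
by have := size_npoly p; case: (size p) p1 => [|[]].
Qed.

Lemma sum_nb_monic_irreducible_le (F : finFieldType) (n m : nat) : (0 < m)%N ->
  (\sum_(1 <= d < n.+1 | d %| m) d * nb_monic_irreducible F n d <= #|F| ^ m)%N.
Proof.
move=> m_gt0.
apply: leq_trans (sum_deg_monic_irreducible_le
  (P := fun p : {poly_n.+1 F} => monic_irreducible p && ((size p).-1 %| m)%N) m_gt0 _); last first.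
  by move=> p /andP[].
rewrite (big_nat_widenl _ 0)// big_mkord.
(* [inord] returns 0 out of range; all degrees here lie between 1 and [n], so it changes none of
   them. *)
rewrite [leqRHS](partition_big (fun p : {poly_n.+1 F} => inord (size p).-1 : 'I_n.+1)
  (fun d => (d %| m)%N && (0 < d)%N)).
  apply/leq_sum => d /andP[dm d0]; rewrite mulnC -sum_nat_const.
  rewrite [leqLHS](eq_bigr (fun p : {poly_n.+1 F} => (size p).-1)); last first.
    by move=> p /andP[_ /eqP ->].
  rewrite [leqLHS]big_mkcond [leqRHS]big_mkcond/=; apply: leq_sum => p _.
  case: ifPn => // /andP[pI /eqP sp].
  by rewrite ifT// pI sp/= dm inord_val eqxx.
by move=> p /andP[/deg_monic_irreducible/andP[sp0 sp] pm]; rewrite inordK// pm.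
Qed.

(** The witness is ['X]. This positivity later sharpens [q ^ d] to [q ^ d - 1] for [1 < d]. *)
Lemma nb_monic_irreducible1_gt0 (F : finFieldType) (n : nat) : (0 < n)%N ->
  (0 < nb_monic_irreducible F n 1)%N.
Proof.
move=> n_gt0; have sX : (size ('X : {poly F}) <= n.+1)%N by rewrite size_polyX.
apply/card_gt0P; exists (NPoly sX); rewrite !inE/= size_polyX eqxx andbT.
apply/andP; split; first exact: monicX.
by apply/irreducibleP; rewrite -['X]addr0; exact: irredp_XaddC.
Qed.

Lemma prod_monic_irreducible (R : realType) (F : finFieldType) (n : nat) :
  \prod_(p : {poly_n.+1 F} | monic_irreducible p) (1 - 1 / (poly_norm p)%:R) =
  \prod_(1 <= d < n.+1) (1 - (#|F|%:R ^- d)) ^+ nb_monic_irreducible F n d :> R.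
Proof.
rewrite big_nat_cond (big_nat_widenl _ 0)// big_mkord.
rewrite (partition_big (fun p : {poly_n.+1 F} => inord (size p).-1 : 'I_n.+1)
  (fun d => (0 < d)%N)).
  apply: eq_big => [d|d d0]; first by rewrite ltn_ord !andbT andbb.
  rewrite -prodr_const; apply: eq_big => p; first rewrite !inE.
    case pI : (monic_irreducible p) => //=.
    have /andP[sp0 sp] := deg_monic_irreducible pI.
    rewrite -val_eqE/= inordK// -eqSS prednK//.
    by case: (size p) sp0.
  move=> /andP[/deg_monic_irreducible/andP[sp0 sp] /eqP <-].
  by rewrite /poly_norm natrX div1r inordK.
by move=> p /deg_monic_irreducible/andP[sp0 sp]; rewrite inordK.
Qed.

(** * Logarithm inequalities and the Euler-Mascheroni constant *)

(** The right side minus the left vanishes at 1 and has derivative (1 - 1/x)^2 / 2. *)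
Lemma ln_lt_subV (R : realType) (t : R) : 1 < t -> ln t < (t - t^-1) / 2.
Proof.
move=> t1.
pose f (x : R) := 2^-1 * (x - x^-1) - ln x.
pose df (x : R) := 2^-1 * (1 - x^-1) ^+ 2.
have fD (x : R) : 0 < x -> is_derive x 1 f (df x).
  move=> x0; have x_neq0 : x != 0 by rewrite gt_eqF.
  have ? := is_derive1_ln x0.
  have ? : is_derive x 1 (fun y : R => y^-1) (- x ^- 2 *: 1) by exact: is_deriveV.
  have -> : f = (2^-1 \*: (id - (fun y : R => y^-1)) - @ln R : R -> R) by [].
  apply: is_derive_eq.
  by rewrite /df /GRing.scale/=; field.
have [| |c] := @MVT R f df 1 t t1.
- by move=> x; rewrite in_itv/= => /andP[/(lt_trans ltr01) x0 _]; exact: fD.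
- apply: derivable_within_continuous => x; rewrite in_itv/= => /andP[/(lt_le_trans ltr01) x0 _].
  by have [] := fD _ x0.
rewrite in_itv/= => /andP[c1 _] fE.
suff : 0 < f t - f 1 by rewrite /f ln1 invr1; lra.
rewrite fE mulr_gt0 ?subr_gt0// /df mulr_gt0 ?invr_gt0// exprn_gt0// subr_gt0 invf_lt1//.
exact: lt_trans c1.
Qed.

(** The right side minus the left vanishes at 0 and has derivative x^(J+1) / ((J+1) (1-x)^2): the
    other terms cancel by the geometric sum. *)
Lemma Nln_le_taylor (R : realType) (u : R) (J : nat) : 0 <= u -> u < 1 ->
  - ln (1 - u) <=
  \sum_(1 <= j < J.+1) u ^+ j / j%:R + u ^+ J.+1 / (J.+1%:R * (1 - u)).
Proof.
move=> u0 u1.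
pose p : {poly R} := \sum_(1 <= j < J.+1) j%:R^-1 *: 'X^j.
pose f (x : R) := p.[x] + J.+1%:R^-1 * (x ^+ J.+1 * (1 - x)^-1) + ln (1 - x).
pose df (x : R) := J.+1%:R^-1 * x ^+ J.+1 / (1 - x) ^+ 2.
have dp (x : R) : p^`().[x] = \sum_(0 <= j < J) x ^+ j.
  rewrite /p raddf_sum/= horner_sum big_add1/=; apply: eq_bigr => j _.
  by rewrite derivZ derivXn hornerZ hornerMn hornerXn/= -[_ ^+ _ *+ _]mulr_natl mulKf ?pnatr_eq0.
have fD (x : R) : x < 1 -> is_derive x 1 f (df x).
  move=> x1; have x_neq1 : 1 - x != 0 by rewrite subr_eq0 gt_eqF.
  have d1 : is_derive x 1 (cst 1 - id : R -> R) (0 - 1) by exact: is_deriveB.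
  have d2 : is_derive x 1 (@ln R \o (cst 1 - id : R -> R)) ((1 - x)^-1 * (0 - 1)).
    by apply: is_derive1_comp; apply: is_derive1_ln; rewrite /= subr_gt0.
  have d3 : is_derive x 1 (fun y : R => ((cst 1 - id : R -> R) y)^-1)
      (- (1 - x) ^- 2 *: (0 - 1)) by exact: is_deriveV.
  have -> : f = (horner p +
     J.+1%:R^-1 \*: ((id : R -> R) ^+ J.+1 * (fun y : R => ((cst 1 - id : R -> R) y)^-1)) +
     (@ln R \o (cst 1 - id : R -> R)) : R -> R).
    by apply/funext => y; rewrite /f !fctE.
  apply: is_derive_eq.
  have geo : \sum_(0 <= j < J) x ^+ j = (1 - x ^+ J) / (1 - x).
    by apply: (mulIf x_neq1); rewrite divfK// big_mkord -[RHS]opprK opprB subrX1 -mulNr opprB mulrC.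
  rewrite dp geo /df /GRing.scale/= exprfctE exprS.
  have := pnatr_eq0 R J.+1; move: (x ^+ J) (J.+1%:R) => y m /= m_neq0.
  rewrite -[(cst 1 - id : R -> R) x]/(1 - x).
  by field; rewrite x_neq1 m_neq0.
have [| |c] := @MVT_segment R f df 0 u u0.
- by move=> x; rewrite in_itv/= => /andP[_ /lt_trans /(_ u1)]; exact: fD.
- apply: derivable_within_continuous => x; rewrite in_itv/= => /andP[_ /le_lt_trans /(_ u1) x1].
  by have [] := fD _ x1.
rewrite in_itv/= => /andP[c0 cu] fE.
have f0 : f 0 = 0.
  rewrite /f subr0 ln1 expr0n/= mul0r mulr0 !addr0 /p horner_sum big_nat_cond big1// => j.
  by rewrite andbT => /andP[j0 _]; rewrite hornerZ hornerXn expr0n gtn_eqF// mulr0.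
have : 0 <= f u - f 0.
  rewrite fE mulr_ge0 ?subr_ge0// /df mulr_ge0// ?invr_ge0 ?sqr_ge0// mulr_ge0// exprn_ge0//.
have -> : \sum_(1 <= j < J.+1) u ^+ j / j%:R = p.[u].
  by rewrite /p horner_sum; apply: eq_bigr => j _; rewrite hornerZ hornerXn mulrC.
have -> : u ^+ J.+1 / (J.+1%:R * (1 - u)) = J.+1%:R^-1 * (u ^+ J.+1 * (1 - u)^-1).
  by rewrite invfM mulrCA.
by rewrite f0 subr0 /f -lerBlDr sub0r.
Qed.

Lemma lt_euler_gamma (R : realType) (N : nat) :
  \sum_(1 <= k < N.+2) k%:R^-1 - ln N.+1%:R - (2 * N.+1%:R)^-1 < euler_gamma R.
Proof.
pose b (N : nat) : R := \sum_(1 <= k < N.+2) k%:R^-1 - ln N.+1%:R - (2 * N.+1%:R)^-1.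
have bS k : b k < b k.+1.
  rewrite /b [in ltRHS]big_nat_recr//=.
  have k1 : 0 < k.+1%:R :> R by rewrite ltr0n.
  have k2 : 0 < k.+2%:R :> R by rewrite ltr0n.
  have t1 : 1 < k.+2%:R / k.+1%:R :> R by rewrite ltr_pdivlMr// mul1r ltr_nat.
  have := ln_lt_subV t1; rewrite ln_div ?posrE//.
  (* This is the increment of [b] from [k] to [k.+1], logarithms aside. *)
  have -> : (k.+2%:R / k.+1%:R - (k.+2%:R / k.+1%:R)^-1) / 2 =
     k.+2%:R^-1 - (2 * k.+2%:R)^-1 + (2 * k.+1%:R)^-1 :> R.
    have : k.+2%:R = k.+1%:R + 1 :> R by rewrite natr1.
    move: k1 k2; move: (k.+1%:R) (k.+2%:R) => x y x0 y0 yx; rewrite yx in y0 *.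
    by field; rewrite !gt_eqF.
  by move: (ln _) (ln _) (_^-1) (_^-1) (_^-1) (\sum_(1 <= _ < _) _) => *; lra.
have b_mono : nondecreasing_seq b by apply/nondecreasing_seqP => k; exact: ltW.
have b_cvg : (b n @[n --> \oo] --> euler_gamma R)%classic.
  have h : (euler_seq R m.+1 @[m --> \oo] --> euler_gamma R)%classic.
    by rewrite cvg_shiftS; exact: is_cvg_euler_seq.
  have h2 : (2^-1 * @harmonic R m @[m --> \oo] --> (0 : R))%classic.
    by rewrite -(mulr0 2^-1); apply: cvgM; [exact: cvg_cst|exact: cvg_harmonic].
  rewrite -[euler_gamma R]subr0.
  have -> : b = (fun m => euler_seq R m.+1 - 2^-1 * @harmonic R m).
    by apply/funext => m; rewrite /b /euler_seq /harmonic/= invfM.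
  exact: (cvgB h h2).
(* Going through [b N.+1] keeps the comparison with the limit strict. *)
apply: lt_le_trans (bS N) _.
rewrite -(cvg_lim _ b_cvg)//; apply: nondecreasing_cvgn_le => //.
by apply/cvg_ex; exists (euler_gamma R).
Qed.

Lemma expR_euler_gamma_gt (R : realType) : 16 / 9 < expR (euler_gamma R).
Proof.
have p : 0 < 16 / 9 :> R by lra.
have p3 : 0 < 1 - 1 / 4 :> R by lra.
have p2 : 0 < 1 - 1 / 3 :> R by lra.
rewrite -(lnK p) ltr_expR.
(* H_8 - ln 8 - 1/16 is about 0.5759, while ln (16/9) is about 0.5754. *)
apply: le_lt_trans (lt_euler_gamma R 7).
(* ln (16 / 9) + ln 8 = 5 ln (4 / 3) + 3 ln (3 / 2) *)
have l3 : - ln (1 - 1 / 4) <= 82 / 285 :> R.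
  apply: le_trans (@Nln_le_taylor R (1 / 4) 4 _ _) _; [lra|lra|].
  have -> : 5%:R * (1 - 1 / 4) = 15 / 4 :> R by lra.
  by rewrite 4?big_ltn// big_geq// invf_div; lra.
have l2 : - ln (1 - 1 / 3) <= 73 / 180 :> R.
  apply: le_trans (@Nln_le_taylor R (1 / 3) 4 _ _) _; [lra|lra|].
  have -> : 5%:R * (1 - 1 / 3) = 10 / 3 :> R by lra.
  by rewrite 4?big_ltn// big_geq// invf_div; lra.
have e : ln (16 / 9 : R) + ln 8%:R = - ln (1 - 1 / 4) *+ 5 + - ln (1 - 1 / 3) *+ 3.
  rewrite -!lnV ?posrE// -!lnXn ?invr_gt0// -!lnM ?posrE ?exprn_gt0 ?invr_gt0//.
  by congr ln; field.
have -> : 2 * 8%:R = 16 :> R by lra.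
by move: e; move: l2 l3; rewrite 8?big_ltn// big_geq//; lra.
Qed.

(** * Main terms and remainders of the logarithm of the product *)

Lemma sum_multiples (R : nmodType) (f : nat -> R) (d n : nat) : (0 < d)%N ->
  \sum_(1 <= m < n.+1 | (d %| m)%N) f m = \sum_(1 <= j < (n %/ d).+1) f (d * j)%N.
Proof.
move=> d0; elim: n => [|n IHn]; first by rewrite div0n !big_geq.
rewrite big_mkcond big_nat_recr//= -big_mkcond/= IHn divnS//.
case: ifP => [dn|_]; last by rewrite addr0.
rewrite add1n [RHS]big_nat_recr//=; congr (_ + f _).
by rewrite -(divnK dn) mulnC divnS// dn add1n.
Qed.

Lemma sum_expr_geometric (R : pzRingType) (v : R) (a b : nat) : (a <= b)%N ->
  (1 - v) * \sum_(a <= d < b) v ^+ d = v ^+ a - v ^+ b.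
Proof.
move=> ab; rewrite big_distrr/=.
rewrite (telescope_sumr_eq (fun d => - v ^+ d))//; first by rewrite opprK addrC.
by move=> d _; rewrite mulrBl mul1r -exprS opprK addrC.
Qed.

Lemma ln_prod (R : realType) (I : Type) (r : seq I) (P : pred I) (f : I -> R) :
  (forall i, P i -> 0 < f i) ->
  ln (\prod_(i <- r | P i) f i) = \sum_(i <- r | P i) ln (f i).
Proof.
move=> f0; elim: r => [|i r IHr]; first by rewrite !big_nil ln1.
rewrite !big_cons; case: ifPn => // Pi.
by rewrite lnM ?IHr// posrE ?f0// prodr_gt0.
Qed.

(* [n %/ d] is the Taylor order used for the factor of index [d]: the main terms
   then involve exactly the multiples [m] of [d] with [m <= n]. *)
Lemma Nln_prod_le (R : realType) (q n : nat) (c : nat -> nat) : (1 < q)%N ->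
  (forall m, (0 < m)%N -> \sum_(1 <= d < n.+1 | d %| m) d * c d <= q ^ m)%N ->
  - ln (\prod_(1 <= d < n.+1) (1 - q%:R ^- d) ^+ c d) <=
  \sum_(1 <= m < n.+1) m%:R^-1 +
  \sum_(1 <= d < n.+1) (d * c d)%:R / (q ^ d - 1)%:R * q%:R ^- (d * (n %/ d)) / n.+1%:R
  :> R.
Proof.
move=> q1 hc; set v : R := q%:R^-1.
have q0 : 0 < q%:R :> R by rewrite ltr0n ltnW.
have v0 : 0 < v by rewrite invr_gt0.
have v1 : v < 1 by rewrite invf_lt1// ltr1n.
have vd0 d : 0 < v ^+ d by rewrite exprn_gt0.
have vd1 d : (0 < d)%N -> v ^+ d < 1 by move=> d0; rewrite exprn_ilt1 ?ltW// -lt0n.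
have term_le d : (0 < d)%N -> - ln (1 - v ^+ d) <=
    \sum_(1 <= m < n.+1 | (d %| m)%N) v ^+ m * (d%:R / m%:R) +
    d%:R / (q ^ d - 1)%:R * v ^+ (d * (n %/ d)) / n.+1%:R.
  move=> d0; apply: le_trans (Nln_le_taylor (n %/ d) (ltW (vd0 d)) (vd1 d d0)) _.
  have d0R : d%:R != 0 :> R by rewrite pnatr_eq0 -lt0n.
  rewrite sum_multiples//; apply: lerD.
    rewrite big_nat_cond [leRHS]big_nat_cond le_eqVlt; apply/orP; left; apply/eqP.
    apply: eq_bigr => j /andP[/andP[j0 _] _].
    have j0R : j%:R != 0 :> R by rewrite pnatr_eq0 -lt0n.
    by rewrite -exprM natrM; field; rewrite d0R j0R.
  have qd1 : (1 < q ^ d)%N by rewrite -(exp1n d) ltn_exp2r.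
  have -> : (q ^ d - 1)%:R = (v ^+ d)^-1 - 1 :> R.
    by rewrite natrB 1?ltnW// natrX /v exprVn invrK.
  rewrite exprM exprS invfM.
  have -> : d%:R / ((v ^+ d)^-1 - 1) * (v ^+ d) ^+ (n %/ d) / n.+1%:R =
      v ^+ d * (v ^+ d) ^+ (n %/ d) * (1 - v ^+ d)^-1 * (d%:R / n.+1%:R).
    move: (vd0 d) (vd1 d d0) (ltr0Sn R n); move: (v ^+ d) (n.+1%:R) => x y x0 x1 y0.
    by field; rewrite !gt_eqF ?subr_gt0.
  rewrite [_^-1 * _]mulrC mulrA ler_wpM2l//.
    by rewrite mulr_ge0 ?invr_ge0 ?subr_ge0 1?ltW ?vd1// -exprS exprn_gt0.
  (* Reduces to n + 1 <= d (n %/ d + 1). *)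
  rewrite -[d%:R in leRHS]invrK -invfM lef_pV2 ?posrE ?mulr_gt0 ?invr_gt0 ?ltr0n//.
  by rewrite ler_pdivrMl ?ltr0n// -natrM ler_nat mulnC ltn_ceil.
have f0 d : (0 < d)%N -> 0 < 1 - q%:R ^- d :> R.
  by move=> d0; rewrite -exprVn subr_gt0 vd1.
rewrite big_nat_cond ln_prod => [|d /andP[/andP[d0 _] _]]; last by rewrite exprn_gt0// f0.
rewrite -sumrN.
apply: (@le_trans _ _ (\sum_(1 <= d < n.+1) (c d)%:R *
    (\sum_(1 <= m < n.+1 | (d %| m)%N) v ^+ m * (d%:R / m%:R) +
    d%:R / (q ^ d - 1)%:R * v ^+ (d * (n %/ d)) / n.+1%:R))).
  rewrite [leRHS]big_nat_cond; apply: ler_sum => d /andP[/andP[d0 _] _].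
  rewrite lnXn ?f0// -exprVn.
  by rewrite -mulNrn -[_ *+ c d]mulr_natl ler_wpM2l// term_le.
under eq_bigr do rewrite mulrDr.
rewrite big_split/=; apply: lerD; last first.
  rewrite le_eqVlt; apply/orP; left; apply/eqP; apply: eq_bigr => d _.
  by rewrite /v exprVn natrM; ring.
under eq_bigr do rewrite big_distrr/= big_mkcond/=.
(* After the exchange, v^m / m has as coefficient the sum of d c_d over d | m, which is at most q^m
   = v^(-m); this leaves 1/m. *)
rewrite exchange_big/= big_nat_cond [leRHS]big_nat_cond; apply: ler_sum => m.
move=> /andP[/andP[m0 _] _].
rewrite -big_mkcond/=.
rewrite (eq_bigr (fun d => (v ^+ m / m%:R) * (d * c d)%:R)); last first.
  by move=> d _; rewrite natrM; ring.
rewrite -big_distrr/= -natr_sum mulrAC ler_piMl ?invr_ge0//.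
by rewrite /v exprVn ler_pdivrMl ?exprn_gt0// mulr1 -natrX ler_nat hc.
Qed.

(** The left side bounds the remainders times n + 1, once c_1 <= q and d c_d <= q^d - 1 are
    inserted. For q = 2 it equals 1, 3/4, 5/8 at n = 1, 2, 3, whence the restriction. *)
Lemma sum_expr_divn_le (R : realType) (q n : nat) : (1 < q)%N -> (0 < n)%N ->
  (2 < q)%N || (3 < n)%N ->
  q%:R / (q%:R - 1) * q%:R ^- n + \sum_(2 <= d < n.+1) q%:R ^- (d * (n %/ d))
    <= 2^-1 :> R.
Proof.
move=> q1 n0 qn; set v : R := q%:R^-1.
have q0 : 0 < q%:R :> R by rewrite ltr0n ltnW.
have v0 : 0 < v by rewrite invr_gt0.
have v2 : v <= 2^-1 by rewrite lef_pV2 ?posrE// ler_nat.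
have -> : q%:R / (q%:R - 1) * q%:R ^- n = v ^+ n / (1 - v) :> R.
  have q1R : q%:R != 1 :> R by rewrite pnatr_eq1 gtn_eqF.
  rewrite exprVn mulrC; congr (_ * _).
  by rewrite /v; field; rewrite subr_eq0 q1R gt_eqF.
under eq_bigr do rewrite -exprVn -/v.
have v1 : 0 < 1 - v by lra.
have dJ d : (1 < d < n.+1)%N -> v ^+ (d * (n %/ d)) <= v ^+ d.
  case/andP => d1 dn; apply: ler_wiXn2l; [exact: ltW|lra|].
  by rewrite leq_pmulr// divn_gt0// ltnW.
have [q3|q2] := ltnP 2 q.
  have v3 : v <= 3^-1 by rewrite lef_pV2 ?posrE// ler_nat.
  (* The geometric sum and v^n <= v bound the total by v / (1 - v), at most 1/2 since v <= 1/3. *)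
  apply: (@le_trans _ _ (v ^+ n / (1 - v) + \sum_(2 <= d < n.+1) v ^+ d)).
    by rewrite lerD2l !big_nat; exact: ler_sum.
  rewrite -(ler_pM2l v1) mulrDr sum_expr_geometric// mulrCA divff ?gt_eqF// mulr1.
  have vn : v ^+ n <= v by rewrite -[leRHS]expr1; apply: ler_wiXn2l; [exact: ltW|lra|].
  have : (1 - v) * v ^+ n <= (1 - v) * v by rewrite ler_pM2l.
  by rewrite [v ^+ n.+1]exprS expr2; lra.
have n4 : (3 < n)%N by move: qn; rewrite ltnNge q2.
have vE : v = 2^-1.
  by rewrite /v; have -> : q = 2%N by apply/eqP; rewrite eqn_leq q2.
rewrite big_ltn ?ltnS ?(leq_trans _ n4)//.
(* Bounding the term d = 2 by v^2 would give 1/2 + v^n in total; with v^4 the total is at most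
   3/8. *)
have h2 : v ^+ (2 * (n %/ 2)) <= v ^+ 4.
  apply: ler_wiXn2l; [exact: ltW|lra|].
  by rewrite (leq_mul2l 2 2) (leq_div2r 2 n4).
have h3 : \sum_(3 <= d < n.+1) v ^+ (d * (n %/ d)) <= \sum_(3 <= d < n.+1) v ^+ d.
  rewrite !big_nat; apply: ler_sum => d /andP[d2 dn].
  by rewrite dJ// dn ltnW.
have := @sum_expr_geometric _ v 3 n.+1; rewrite ltnS (ltnW (ltnW n4)) => /(_ isT).
have vn : v ^+ n <= v ^+ 4 by apply: ler_wiXn2l; [exact: ltW|lra|].
have -> : v ^+ n / (1 - v) = v ^+ n * 2 by rewrite vE; field.
move: vn h2 h3; rewrite [v ^+ n.+1]exprS.
move: (v ^+ n) (v ^+ (2 * _)) (\sum_(_ <= _ < _) _) (\sum_(_ <= _ < _) _) => a b c d.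
by rewrite vE; lra.
Qed.

(** * Bounds on single counts, and the cases q = 2, n = 2, 3 *)

(** The hypotheses force c_1 <= 2, c_2 <= 1 and, for n = 3, c_3 <= 2; the bases lie in [0, 1], so
    the largest exponents give the minimum: 9/16 for n = 2 and 147/256 for n = 3. *)
Lemma prod_count2_ge (R : realType) (n : nat) (c : nat -> nat) :
  (n == 2) || (n == 3) -> (0 < c 1%N)%N ->
  (forall m, (0 < m)%N -> \sum_(1 <= d < n.+1 | d %| m) d * c d <= 2 ^ m)%N ->
  9 / 16 <= \prod_(1 <= d < n.+1) (1 - 2%:R ^- d) ^+ c d * n.+1%:R :> R.
Proof.
move=> n23 c1 hc.
have h1 := hc 1%N isT; have h2 := hc 2%N isT; have h3 := hc 3%N isT.
have pw (x : R) (a b : nat) : 0 <= x -> x <= 1 -> (a <= b)%N -> x ^+ b <= x ^+ a.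
  by move=> *; exact: ler_wiXn2l.
have p1 (k : nat) : (k <= 2)%N -> 1 / 4 <= (1 - 2%:R ^- 1) ^+ k :> R.
  move=> k2; apply: le_trans (pw _ _ _ _ _ k2); lra.
have p2 (k : nat) : (k <= 1)%N -> 3 / 4 <= (1 - 2%:R ^- 2) ^+ k :> R.
  move=> k2; apply: le_trans (pw _ _ _ _ _ k2); lra.
have p3 (k : nat) : (k <= 2)%N -> 49 / 64 <= (1 - 2%:R ^- 3) ^+ k :> R.
  move=> k2; apply: le_trans (pw _ _ _ _ _ k2); lra.
have i2 : index_iota 1 3 = [:: 1; 2]%N by [].
have i3 : index_iota 1 4 = [:: 1; 2; 3]%N by [].
case/orP: n23 => /eqP nE; subst n; rewrite ?(i2, i3).
  move: h1 h2 {h3 hc}; rewrite i2 !big_cons !big_nil/= => h1 h2.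
  have /p1 P1 : (c 1%N <= 2)%N by lia.
  have /p2 P2 : (c 2%N <= 1)%N by lia.
  rewrite mulr1; apply: le_trans (_ : 1 / 4 * (3 / 4) * 3 <= _); first by lra.
  by rewrite ler_pM// ?ler_pM//; lra.
move: h1 h2 h3 {hc}; rewrite i3 !big_cons !big_nil/= => h1 h2 h3.
have /p1 P1 : (c 1%N <= 2)%N by lia.
have /p2 P2 : (c 2%N <= 1)%N by lia.
have /p3 P3 : (c 3%N <= 2)%N by lia.
rewrite mulr1; apply: le_trans (_ : 1 / 4 * (3 / 4 * (49 / 64)) * 4 <= _); first by lra.
by rewrite ler_pM// ?ler_pM//; lra.
Qed.

(* The term e = 1 of the sum is at least 1, whence the [- 1]. *)
Lemma mul_count_le (q n d : nat) (c : nat -> nat) : (0 < c 1)%N ->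
  (forall m, (0 < m)%N -> \sum_(1 <= e < n.+1 | e %| m) e * c e <= q ^ m)%N ->
  (1 < d < n.+1)%N -> (d * c d <= q ^ d - 1)%N.
Proof.
move=> c1 hc /andP[d1 dn].
have := hc d (ltnW d1).
rewrite big_ltn_cond ?(ltn_trans _ dn)// dvd1n mul1n big_mkcond.
rewrite (bigD1_seq d) ?mem_index_iota ?d1 ?iota_uniq//= dvdnn.
by move: c1; lia.
Qed.

(** * Combining the estimates *)

Lemma prod_count_gt (R : realType) (q n : nat) (c : nat -> nat) :
  (1 < q)%N -> (0 < n)%N -> ~ (q = 2 /\ n = 1)%N -> (0 < c 1)%N ->
  (forall m, (0 < m)%N -> \sum_(1 <= e < n.+1 | e %| m) e * c e <= q ^ m)%N ->
  (expR (euler_gamma R) * n.+1%:R)^-1 < \prod_(1 <= d < n.+1) (1 - q%:R ^- d) ^+ c d.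
Proof.
move=> q1 n0 qn c1 hc.
have n1R : 0 < n.+1%:R :> R by rewrite ltr0n.
have [qn'|] := boolP ((2 < q)%N || (3 < n)%N); last first.
  rewrite negb_or -!leqNgt => /andP[q2 n3].
  have qE : q = 2%N by lia.
  subst q; have n23 : (n == 2%N) || (n == 3%N) by lia.
  have := @prod_count2_ge R n c n23 c1 hc.
  have := expR_euler_gamma_gt R.
  move=> g h; rewrite invfM ltr_pdivrMr//; apply: lt_le_trans h.
  rewrite invf_plt ?posrE ?expR_gt0//; lra.
have q0 : 0 < q%:R :> R by rewrite ltr0n ltnW.
have P0 : 0 < \prod_(1 <= d < n.+1) (1 - q%:R ^- d) ^+ c d :> R.
  rewrite big_nat_cond prodr_gt0// => d /andP[/andP[d0 _] _].
  by rewrite exprn_gt0// subr_gt0 invf_lt1 ?exprn_gt0// exprn_egt1 ?ltr1n// -lt0n.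
rewrite -[ltRHS]lnK ?posrE// -[_^-1]lnK ?posrE ?invr_gt0 ?mulr_gt0 ?expR_gt0//.
rewrite ltr_expR lnV ?posrE ?mulr_gt0 ?expR_gt0// lnM ?posrE ?expR_gt0// expRK ltrNl.
apply: le_lt_trans (Nln_prod_le R q1 hc) _.
(* Splitting off 1/(n+1) gives H_n + 1/(2(n+1)) < gamma + ln (n+1), so the remainders may use up
   1/(2(n+1)). *)
have gam := lt_euler_gamma R n; rewrite big_nat_recr//= in gam.
suff : \sum_(1 <= d < n.+1)
     (d * c d)%:R / (q ^ d - 1)%:R * q%:R ^- (d * (n %/ d)) / n.+1%:R <=
     2^-1 / n.+1%:R :> R.
  move: gam; rewrite invfM.
  move: (ln _) (n.+1%:R^-1) (\sum_(1 <= _ < _) _ / _) (\sum_(1 <= _ < _) _) => a b c' d; lra.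
rewrite -mulr_suml ler_pM2r ?invr_gt0//.
apply: le_trans (sum_expr_divn_le R q1 n0 qn').
(* The term d = 1 is set apart: there only c_1 <= q is known, while [mul_count_le] bounds the ratio
   by 1 for d >= 2. *)
rewrite big_ltn// divn1 mul1n mul1n expn1; apply: lerD.
  rewrite ler_wpM2r ?invr_ge0 ?exprn_ge0 ?(ltW q0)//.
  rewrite natrB ?(ltnW q1)// ler_pM2r ?invr_gt0 ?subr_gt0 ?ltr1n// ler_nat.
  have := hc 1%N isT; rewrite big_ltn_cond//= mul1n expn1; lia.
rewrite !big_nat; apply: ler_sum => d dn.
rewrite ler_piMl ?invr_ge0 ?exprn_ge0 ?(ltW q0)//.
have qd : (1 < q ^ d)%N by rewrite -(exp1n d) ltn_exp2r//; lia.
rewrite ler_pdivrMr ?ltr0n ?subn_gt0// mul1r ler_nat.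
exact: mul_count_le hc dn.
Qed.

Theorem proposition3p4 (R : realType) (q : nat) (F : finFieldType) (n : nat)
    (hq : #|F| = q) (hn : (0 < n)%N) (hqn : ~ (q = 2%N /\ n = 1%N)) :
  \prod_(p : {poly_n.+1 F} | monic_irreducible p)
      (1 - 1 / (poly_norm p)%:R) >
    1 / (expR (euler_gamma R) * (n%:R + 1)).
Proof.
rewrite prod_monic_irreducible hq div1r natr1; apply: prod_count_gt => //.
- by rewrite -hq card_finNzRing_gt1.
- exact: nb_monic_irreducible1_gt0.
- by move=> m m0; rewrite -hq; exact: sum_nb_monic_irreducible_le.
Qed.
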